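(* Let $t\in\mathbb{N}$, $c\in\mathbb{R}_{>0}$, and let $H=(V,\mathcal{E})$ be a finite hypergraph with the Hereditary Linear Delaunay property with parameter $c$. Then $\chi_{t\text{-UM}}(H)=O(c\,t\log|V|)$, with an absolute implied constant.
   Context: For $V'\subseteq V$, $H[V']=(V',\{h\cap V': h\in\mathcal{E}\})$. The Delaunay graph of $H$ is $\mathrm{Del}(H)=(V,\{h\in\mathcal{E}: |h|=2\})$. $H$ has the Hereditary Linear Delaunay property with parameter $c$ if for every $V'\subseteq V$ the graph $\mathrm{Del}(H[V'])$ has at most $c|V'|$ edges. A $t$-UM-colouring of $H$ is a colouring of $V$ with an ordered set of colours (e.g. integers) such that in every $h\in\mathcal{E}$ the $\min\{|h|,t\}$ largest colours appearing in $h$ each appear exactly once in $h$; $\chi_{t\text{-UM}}(H)$ is the least number of colours of such a colouring.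
   Formalization: The bound proved is max(1, C·c·t·log|V|): the literal bound fails when t = 0, when |V| = 1, or when no hyperedge has two vertices and c is tiny (one colour is needed, but the right side is 0 or arbitrarily small); otherwise the maximum is absorbed into C. *)

(* Defs.v *)
From HB Require Import structures.
From mathcomp Require Import all_boot all_order all_algebra.
From mathcomp Require Import reals.

Set Implicit Arguments.
Unset Strict Implicit.
Unset Printing Implicit Defensive.

Import Order.TTheory GRing.Theory Num.Theory.

(* A finite hypergraph is a finite type V of vertices together with a set
   E : {set {set V}} of hyperedges.  The subhypergraph H[V'] is represented by
   its hyperedges, which are subsets of V' but still of type {set V}. *)
Definition induced_edges (V : finType) (E : {set {set V}}) (V' : {set V}) :
    {set {set V}} :=
  [set h :&: V' | h in E].

Definition delaunay_edges (V : finType) (E : {set {set V}}) : {set {set V}} :=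
  [set h in E | #|h| == 2].

Definition hereditary_linear_delaunay (R : realType) (V : finType)
    (c : R) (E : {set {set V}}) : Prop :=
  forall V' : {set V},
    ((#|delaunay_edges (induced_edges E V')|)%:R <= c * (#|V'|)%:R)%R.

Definition among_largest (k m : nat) (A : {set 'I_k}) (a : 'I_k) : bool :=
  (a \in A) && (#|[set b in A | a < b]| < m).

(* If fewer than minn #|h| t colours appear in h, then among_largest selects
   all of them; they cannot all appear exactly once, since there are fewer than
   #|h| of them, so such an f is rejected, as it should be. *)
Definition um_colouring (V : finType) (t : nat) (E : {set {set V}})
    (k : nat) (f : {ffun V -> 'I_k}) : bool :=
  [forall h in E, forall a : 'I_k,
    among_largest (minn #|h| t) (f @: h) a ==> (#|[set v in h | f v == a]| == 1)].

Definition um_colourable (V : finType) (t : nat) (E : {set {set V}})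
    (k : nat) : bool :=
  [exists f : {ffun V -> 'I_k}, um_colouring t E f].

Lemma um_colourable_card (V : finType) (t : nat) (E : {set {set V}}) :
  exists k, um_colourable t E k.
Proof.
exists #|V|; apply/existsP; exists [ffun v => enum_rank v].
apply/forall_inP => h _; apply/forallP => a; apply/implyP => /andP[+ _].
case/imsetP => v vh ->; apply/cards1P; exists v; apply/setP => w.
rewrite !inE !ffunE (inj_eq enum_rank_inj).
by case: eqP => [->|]; rewrite ?vh ?andbF.
Qed.

Definition chi_um (V : finType) (t : nat) (E : {set {set V}}) : nat :=
  ex_minn (um_colourable_card t E).

(* Main.v *)
(* Call two vertices of W close if some hyperedge h with at most k = t + 1
   vertices in W contains both.  By a Clarkson-Shor sampling argument W has
   O(c k |W|) close pairs, hence a vertex with O(c k) close partners.  Removing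
   such vertices one at a time and colouring greedily in the reverse order gives
   a colouring of W with O(c k) colours in which every h contains
   min(|h :&: W|, k) vertices of distinct colours.  Its largest class is used as
   the next (lowest) colour and removed, and a 1 - 1 / O(c t) fraction of W
   remains, so O(c t log |V|) rounds suffice. *)
Require Import Defs.
From HB Require Import structures.
From mathcomp Require Import all_boot all_order all_algebra.
From mathcomp Require Import reals sequences exp.
From mathcomp Require Import zify ring lra.

Set Implicit Arguments.
Unset Strict Implicit.
Unset Printing Implicit Defensive.

Import Order.TTheory GRing.Theory Num.Theory.

(** * Random sampling and the number of close pairs *)

(** Bernoulli's inequality $(1-1/m)^j \ge 1-j/m$, cleared of denominators. *)
Lemma bernoulli_nat (m j : nat) :
  j <= m -> (m - j) * m ^ j <= m * m.-1 ^ j.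
Proof.
elim: j => [|j IH] jm; first by rewrite subn0.
have := IH (ltnW jm); rewrite !expnS.
set x := m ^ j; set y := _ ^ j => le.
apply: (@leq_trans (m.-1 * ((m - j) * x))); last by nia.
by rewrite !mulnA leq_mul2r; apply/orP; right; nia.
Qed.

(** At sampling density $1/2k$, a set of [j <= k] vertices is missed entirely with probability at
    least $1/2$. *)
Lemma expn_double_pred (k j : nat) :
  0 < k -> j <= k -> k.*2 ^ j <= 2 * k.*2.-1 ^ j.
Proof.
move=> k0 jk; have /bernoulli_nat : j <= k.*2 by lia.
set x := _ ^ j; set y := _ ^ j => le.
rewrite -(leq_pmul2l k0); apply: (@leq_trans ((k.*2 - j) * x)); nia.
Qed.

(** The zero fibre of a uniform map to ['I_M.+1] models a random vertex set of density [1 / M.+1].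
    Vertices are independent: one choice on [e], [M] on the rest of [A], [M.+1] elsewhere. *)
Lemma card_trace_ord0 (V : finType) (M : nat) (A e : {set V}) :
  e \subset A ->
  #|[set g : {ffun V -> 'I_M.+1} | A :&: [set v | g v == ord0] == e]| =
  M ^ (#|A| - #|e|) * M.+1 ^ (#|V| - #|A|).
Proof.
move=> eA.
pose F (v : V) : pred 'I_M.+1 :=
  if v \in e then pred1 ord0 else if v \in A then predC1 ord0 else predT.
have -> : #|[set g : {ffun V -> 'I_M.+1} | A :&: [set v | g v == ord0] == e]|
    = #|(family F : pred {ffun V -> 'I_M.+1})|.
  apply: eq_card => g; rewrite inE; apply/eqP/familyP => [ge v|gF].
    rewrite /F; have := in_setI v A [set v | g v == ord0]; rewrite ge inE.
    case: ifP => [_ /esym/andP[]//|_].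
    by case: ifP => //= _ /esym/negbT.
  apply/setP => v; have := gF v; rewrite /F !inE.
  case: ifP => [ve|_]; first by rewrite inE (subsetP eA) // => ->.
  by case: ifP => //= _; rewrite inE => /negbTE.
rewrite card_family foldrE big_map big_enum /=.
rewrite (bigID (mem e)) /= big1 ?mul1n; last first.
  by move=> v ve; rewrite /F ve card1.
rewrite (bigID (mem A)) /=; congr (_ * _).
  rewrite (eq_bigr (fun=> M)); last first.
    move=> v /andP[/negbTE ve vA]; rewrite /F ve vA.
    by have := cardC (pred1 (@ord0 M)); rewrite card1 card_ord add1n => -[].
  rewrite prod_nat_const; congr (_ ^ _).
  rewrite -cardsDS // -sum1_card -sum1_card; apply: eq_bigl => v.
  by rewrite !inE.
rewrite (eq_bigr (fun=> M.+1)); last first.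
  move=> v /andP[/negbTE ve /negbTE vA]; rewrite /F ve vA.
  by rewrite -[RHS]card_ord; apply: eq_card.
rewrite prod_nat_const; congr (_ ^ _).
rewrite -cardsT -cardsDS ?subsetT // -sum1_card -sum1_card.
apply: eq_bigl => v; rewrite !inE andbT.
rewrite unfold_in.
by case: (boolP (v \in A)) => [|/(contra (subsetP eA v)) ->]; rewrite ?andbF.
Qed.

Definition close_pairs (V : finType) (E : {set {set V}}) (W : {set V})
    (k : nat) : {set {set V}} :=
  [set e : {set V} | (#|e| == 2) &&
    [exists h in E, (e \subset h :&: W) && (#|h :&: W| <= k)]].

Lemma exchange_card (I J : finType) (A : {set I}) (r : I -> J -> bool) :
  \sum_(j : J) #|[set i in A | r i j]| = \sum_(i in A) #|[set j | r i j]|.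
Proof.
under eq_bigr do rewrite -sum1_card.
under [RHS]eq_bigr do rewrite -sum1_card.
rewrite (exchange_big_dep (mem A)) /=; last by move=> j i _; rewrite inE => /andP[].
by apply: eq_bigr => i iA; apply: eq_bigl => j; rewrite !inE iA.
Qed.

(* A pair close in [W] is a Delaunay edge of a random subset of [W] of density
   [p = 1 / 2k] with probability at least [p ^ 2 / 2], while the expected number
   of such edges is at most [c * p * #|W|]. *)
Lemma card_close_pairs (R : realType) (V : finType) (E : {set {set V}}) (c : R)
    (W : {set V}) (k : nat) :
  (0 < c)%R -> hereditary_linear_delaunay c E -> 0 < k ->
  (#|close_pairs E W k|%:R <= 4 * c * k%:R * #|W|%:R)%R.
Proof.
move=> c0 hE k0; set P := close_pairs E W k.
have [->|[e0 e0P]] := set_0Vmem P.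
  by rewrite cards0 !mulr_ge0 // ltW.
have n2 : 2 <= #|V|.
  by move: e0P; rewrite inE => /andP[/eqP <- _]; apply: max_card.
pose M := k.*2.-1; have M1 : M.+1 = k.*2 by rewrite /M; lia.
pose S (g : {ffun V -> 'I_M.+1}) := W :&: [set v | g v == ord0].
pose D g := delaunay_edges (induced_edges E (S g)).
(* Expectations are kept as sums over all [M.+1 ^ #|V|] maps [g], so the counting stays in [nat]. *)
have sumS : \sum_g #|S g| = #|W| * M.+1 ^ (#|V|.-1).
  have -> : \sum_g #|S g| =
      \sum_(g : {ffun V -> 'I_M.+1}) #|[set v in W | g v == ord0]|.
    by apply: eq_bigr => g _; apply: eq_card => v; rewrite !inE.
  rewrite exchange_card -sum_nat_const; apply: eq_bigr => v vW.
  have := card_trace_ord0 M (subxx [set v]).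
  rewrite subnn mul1n cards1 subn1 => <-; apply: eq_card => g.
  rewrite !inE; apply/idP/eqP => [gv|/setP/(_ v)]; last by rewrite !inE eqxx.
  by apply/setIidPl; rewrite sub1set inE.
have sumD : #|P| * M.+1 ^ (#|V| - 2) <= 2 * \sum_g #|D g|.
  apply: (@leq_trans (2 * \sum_g #|[set e in P | e \in D g]|)); last first.
    rewrite leq_pmul2l // leq_sum // => g _; apply/subset_leq_card/subsetP => e.
    by rewrite inE => /andP[].
  rewrite exchange_card -sum_nat_const big_distrr /=; apply: leq_sum => e.
  rewrite inE => /andP[/eqP e2 /exists_inP[h hH /andP[eh hk]]].
  have := subset_leq_card eh; rewrite e2 => h2.
  have hn : #|h :&: W| <= #|V| by apply: max_card.
  (* A sample that meets [h :&: W] exactly in [e] makes [e] a Delaunay edge. *)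
  apply: (@leq_trans (2 * #|[set g : {ffun V -> 'I_M.+1} |
       (h :&: W) :&: [set v | g v == ord0] == e]|)); last first.
    rewrite leq_pmul2l //; apply/subset_leq_card/subsetP => g.
    rewrite !inE => /eqP ge; rewrite -[X in X \in _]ge ge e2 eqxx andbT.
    by apply/imsetP; exists h; rewrite // setIA ge.
  rewrite card_trace_ord0 // e2.
  have -> : #|V| - 2 = (#|h :&: W| - 2) + (#|V| - #|h :&: W|) by lia.
  rewrite expnD mulnA leq_mul2r; apply/orP; right.
  by rewrite M1; apply: expn_double_pred => //; lia.
have : ((\sum_g #|D g|)%:R <= c * (\sum_g #|S g|)%:R :> R)%R.
  rewrite !natr_sum mulr_sumr; apply: ler_sum => g _; exact: hE.
rewrite sumS => le.
have e1 : #|V|.-1 = (#|V| - 2).+1 by lia.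
have k2 : (M.+1%:R = 2 * k%:R :> R)%R by rewrite M1 -mul2n natrM.
move: sumD; rewrite -(ler_nat R) !natrM => le2.
move: le; rewrite e1 expnS !natrM k2.
have : (0 < (M.+1 ^ (#|V| - 2))%:R :> R)%R by rewrite ltr0n expn_gt0.
move: le2; set x := (_ ^ _)%:R%R => le2 x0 le.
rewrite -(ler_pM2r x0); apply: le_trans le2 _; lra.
Qed.

(** * Greedy rainbow colouring *)

(** Averaging: each close pair has both ends in [W], so the degrees sum to twice the number of
    pairs. *)
Lemma exists_low_degree (V : finType) (E : {set {set V}}) (W : {set V})
    (k q : nat) :
  2 * #|close_pairs E W k| < #|W| * q ->
  exists2 v, v \in W & #|[set e in close_pairs E W k | v \in e]| < q.
Proof.
set P := close_pairs E W k => sparse.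
apply/exists_inP; move: sparse; apply: contraTT.
rewrite negb_exists_in -leqNgt => /forall_inP big.
have -> : 2 * #|P| = \sum_(e in P) #|[set v in W | v \in e]|.
  rewrite mulnC -sum_nat_const; apply: eq_bigr => e.
  rewrite inE => /andP[/eqP <- /exists_inP[h _ /andP[eh _]]].
  apply: eq_card => v; rewrite inE andb_idl // => /(subsetP eh).
  by rewrite inE => /andP[].
rewrite -sum_nat_const.
under [X in _ <= X]eq_bigr do rewrite -sum1_card.
rewrite (exchange_big_dep (mem W)) /=; last by move=> e v _; rewrite inE => /andP[].
apply: leq_sum => v vW; apply: leq_trans (_ : #|[set e in P | v \in e]| <= _).
  by rewrite leqNgt big.
by rewrite -sum1_card; apply: eq_leq; apply: eq_bigl => e; rewrite !inE vW.
Qed.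

(* Colouring greedily in an order where every vertex has fewer than [q] close
   partners among its predecessors; an edge [h] is rainbow on its first
   [minn #|h| k] vertices. *)
Lemma rainbow_colouring (V : finType) (E : {set {set V}}) (k q : nat) :
  (forall W : {set V}, W != set0 -> 2 * #|close_pairs E W k| < #|W| * q) ->
  forall W : {set V}, exists2 f : V -> nat,
    {in W, forall v, f v < q} &
    forall h, h \in E -> exists T : {set V},
      [/\ T \subset h :&: W, #|T| = minn #|h :&: W| k & {in T &, injective f}].
Proof.
move=> sparse W; move: {2}#|W| (leqnn #|W|) => n.
elim: n W => [|n IH] W.
  rewrite leqn0 cards_eq0 => /eqP ->; exists (fun=> 0) => [v|h _].
    by rewrite inE.
  by exists set0; rewrite sub0set setI0 cards0 min0n; split=> // u v; rewrite inE.
have [-> _|W0 Wn] := eqVneq W set0; first by apply: IH; rewrite cards0.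
have [v vW deg] := exists_low_degree (sparse _ W0).
have [|f fq fT] := IH (W :\ v).
  by move: Wn; rewrite (cardsD1 v W) vW ltnS.
set P := close_pairs E W k in deg.
pose N := [set u in W :\ v | [set u; v] \in P].
have Nq : #|N| < q.
  apply: leq_ltn_trans deg; rewrite -(card_in_imset (f := fun u => [set u; v])).
    apply/subset_leq_card/subsetP => _ /imsetP[u + ->].
    by rewrite !inE eqxx orbT andbT => /andP[].
  move=> u w; rewrite !inE -!andbA => /andP[uv _] /andP[wv _] /setP/(_ u).
  by rewrite !inE eqxx (negbTE uv) !orbF => /esym/eqP.
have [a aq aN] : exists2 a, a < q & forall u, u \in N -> f u != a.
  have /existsP[a /forall_inP aP] :
      [exists a : 'I_q, [forall u in N, f u != a]].
    apply: contraLR Nq; rewrite negb_exists => /forallP sur; rewrite -leqNgt.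
    rewrite -[X in X <= _](size_iota 0) cardE -(size_map f).
    apply: uniq_leq_size (iota_uniq _ _) _ => i; rewrite mem_iota add0n => /andP[_ iq].
    have := sur (Ordinal iq); rewrite negb_forall_in => /exists_inP[u uN].
    by rewrite negbK => /eqP /= <-; apply: map_f; rewrite mem_enum.
  by exists a.
exists (fun u => if u == v then a else f u) => [u uW|h hE].
  by case: eqP => // /eqP uv; apply: fq; rewrite !inE uv.
have [T [Th Tc Ti]] := fT h hE.
have Tv u : u \in T -> (u == v) = false.
  by move=> /(subsetP Th); rewrite !inE => /and3P[_ /negbTE].
have Tsub : T \subset h :&: W.
  by apply: subset_trans Th _; rewrite setIS // subD1set.
have Ti' : {in T &, injective (fun u => if u == v then a else f u)}.
  by move=> u w uT wT /=; rewrite !Tv //; apply: Ti.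
have split_v : #|h :&: W| = (v \in h) + #|h :&: (W :\ v)|.
  rewrite (cardsD1 v) inE vW andbT; congr (_ + _).
  by apply: eq_card => u; rewrite !inE andbCA.
have [vh|vh] := boolP (v \in h); last first.
  by exists T; rewrite split_v (negbTE vh).
rewrite vh add1n in split_v.
have [hk|hk] := ltnP k #|h :&: W|.
  by exists T; split=> //; rewrite Tc; lia.
exists (h :&: W); split=> //.
have TE : T = h :&: (W :\ v).
  by apply/eqP; rewrite eqEcard Th Tc; lia.
(* Here all other vertices of [h :&: W] are close to [v], so they lie in [N] and avoid the colour
   [a]. *)
have fa u : u \in h :&: W -> u != v -> f u != a.
  rewrite inE => /andP[uh uW] uv; apply: aN; rewrite !inE uW uv cards2 uv /=.
  apply/exists_inP; exists h => //; rewrite hk andbT.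
  by apply/subsetP => w; rewrite !inE => /orP[] /eqP ->; apply/andP.
move=> u w uh wh /=; case: eqP => [->|/eqP uv]; case: eqP => [->|/eqP wv] //.
- by move=> /esym/eqP; rewrite (negbTE (fa _ _ _)).
- by move=> /eqP; rewrite (negbTE (fa _ _ _)).
by apply: Ti; rewrite TE !inE ?uv ?wv; move: uh wh; rewrite !inE.
Qed.

(** * From rainbow to unique-maximum colourings *)

(* Colours are handed out from the lowest up.  The next one goes to the largest
   class of a rainbow colouring with [k = t.+1]: an edge that loses two vertices
   keeps at least [t] others, which all receive larger colours. *)
Lemma um_rounds (V : finType) (E : {set {set V}}) (t q : nat) :
  (forall W : {set V}, W != set0 -> 2 * #|close_pairs E W t.+1| < #|W| * q) ->
  forall (j : nat) (W : {set V}), #|W| * q.-1 ^ j < q ^ j ->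
  exists2 f : V -> nat,
    {in W, forall v, f v < j} &
    forall h u v, h \in E -> u \in h :&: W -> v \in h :&: W ->
      u != v -> f u = f v ->
      exists T : {set V}, [/\ T \subset h :&: W, #|T| = t,
        {in T &, injective f} & {in T, forall w, f u < f w}].
Proof.
move=> sparse; elim=> [|j IH] W Wj.
  move: Wj; rewrite !expn0 muln1 ltnS leqn0 cards_eq0 => /eqP ->.
  by exists (fun=> 0) => [v|h u v _]; rewrite ?setI0 inE.
have [->|W0] := eqVneq W set0.
  by exists (fun=> 0) => [v|h u v _]; rewrite ?setI0 inE.
have [g gq gT] := rainbow_colouring sparse W.
have q0 : 0 < q by have [v /gq] := set0Pn _ W0; apply: leq_trans.
pose I (a : nat) := [set v in W | g v == a].
have [a Ia] : exists a, #|W| <= #|I a| * q.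
  have /existsP[a] : [exists a : 'I_q, #|W| <= #|I a| * q]; last by exists a.
  apply: contraT; rewrite negb_exists => /forallP small.
  have : \sum_(a < q) #|I a| * q <= \sum_(a < q) #|W|.-1.
    by apply: leq_sum => a _; have := small a; lia.
  rewrite sum_nat_const card_ord -big_distrl /=.
  have -> : \sum_(a < q) #|I a| = #|W|.
    rewrite (exchange_card W (fun v (b : 'I_q) => g v == b)) -sum1_card.
    apply: eq_bigr => v vW; apply/eqP/cards1P; exists (Ordinal (gq v vW)).
    by apply/setP => b; rewrite !inE -val_eqE eq_sym.
  have : 0 < #|W| by rewrite card_gt0.
  by nia.
have cardI : #|W| = #|I a| + #|W :\: I a|.
  rewrite -(cardsID (I a) W); congr (_ + _).
  by apply: eq_card => v; rewrite !inE andbA andbb.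
(* The class takes at least a $1/q$ fraction of [W], so the invariant $|W|(1-1/q)^j < 1$ survives
   with one round fewer. *)
have [|f fj fT] := IH (W :\: I a).
  rewrite -(ltn_pmul2l q0) -expnS; apply: leq_ltn_trans Wj.
  rewrite expnS !mulnA leq_mul2r; apply/orP; right; nia.
pose f' v := if v \in I a then 0 else (f v).+1.
have f'E v : v \notin I a -> f' v = (f v).+1 by rewrite /f' => /negbTE ->.
have sub_rest h : h :&: (W :\: I a) \subset h :&: W by rewrite setIS // subsetDl.
have rest v h : v \in h :&: (W :\: I a) -> v \notin I a.
  by rewrite in_setI in_setD => /and3P[].
have f'inj (T h : {set V}) : T \subset h :&: (W :\: I a) ->
    {in T &, injective f} -> {in T &, injective f'}.
  move=> Th fi u v uT vT; rewrite !f'E ?(rest _ h) ?(subsetP Th) //.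
  by case; apply: fi.
exists f' => [v vW|h u v hE uh vh uv].
  by rewrite /f'; case: ifP => // /negbT vI; rewrite ltnS fj // inE vI.
rewrite /f'; case: ifP => uI; case: ifP => // vI.
  move=> _.
  have [T0 [T0h T0c T0i]] := gT h hE.
  (* Since [u] and [v] share a class of [g], [h :&: W] is not rainbow and so has more than [t]
     vertices. Then [T0] has [t.+1], at most one of them in the class. *)
  have many : t <= #|h :&: (W :\: I a)|.
    have [hk|hk] := ltnP t #|h :&: W|; last first.
      have T0E : T0 = h :&: W by apply/eqP; rewrite eqEcard T0h T0c; lia.
      case/eqP: uv; apply: T0i; rewrite ?T0E //.
      by move: uI vI; rewrite !inE => /andP[_ /eqP ->] /andP[_ /eqP ->].
    have T0I : #|T0 :&: I a| <= 1.
      apply/card_le1_eqP => x y; rewrite !inE.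
      by move=> /and3P[xT _ /eqP gx] /and3P[yT _ /eqP gy]; apply: T0i; rewrite ?gx.
    have : #|T0 :\: I a| <= #|h :&: (W :\: I a)|.
      by rewrite subset_leq_card // setIDA setSD.
    by have := cardsID (I a) T0; lia.
  suff [T [Th Tc Ti]] : exists T : {set V}, [/\ T \subset h :&: (W :\: I a),
      #|T| = t & {in T &, injective f}].
    exists T; split=> //; first exact: subset_trans Th _.
      exact: f'inj Th Ti.
    by move=> w /(subsetP Th) /rest /negbTE ->.
  (* Either [f] is injective on the rest of [h] and any [t] vertices serve, or a repeated colour
     there yields [T] by induction. *)
  have [fi|] := boolP (dinjectiveb f (h :&: (W :\: I a))).
    have [s [s_uniq s_size sh]] := card_geqP many.
    exists [set x in s]; split.
    - by apply/subsetP => x; rewrite inE => /sh.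
    - by rewrite cardsE (card_uniqP s_uniq).
    by move=> x y; rewrite !inE => /sh xh /sh yh; apply: (dinjectiveP _ _ fi).
  case/dinjectivePn => x xh [y]; rewrite inE => /andP[yx yh] fxy.
  rewrite eq_sym in yx.
  by have [T [? ? ? _]] := fT h x y hE xh yh yx fxy; exists T.
case=> fuv; have [||T [Th Tc Ti Tu]] := fT h u v hE _ _ uv fuv.
- by move: uh; rewrite !in_setI in_setD uI.
- by move: vh; rewrite !in_setI in_setD vI.
exists T; split=> //; first exact: subset_trans Th _.
  exact: f'inj Th Ti.
by move=> w wT; rewrite (negbTE (rest _ _ (subsetP Th _ wT))) ltnS Tu.
Qed.

(** A colour repeated in [h] has the [t] colours of [T] above it, so it is not among the largest
    ones that must be unique. *)
Lemma chi_um_le (V : finType) (E : {set {set V}}) (t j : nat) (f : V -> nat) :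
  (forall v, f v < j) ->
  (forall h u v, h \in E -> u \in h -> v \in h -> u != v -> f u = f v ->
    exists T : {set V}, [/\ T \subset h, #|T| = t,
      {in T &, injective f} & {in T, forall w, f u < f w}]) ->
  chi_um t E <= j.
Proof.
move=> fj fT; rewrite /chi_um; case: ex_minnP => k _; apply.
apply/existsP; exists [ffun v => Ordinal (fj v)]; set F := finfun _.
have FE v : F v = f v :> nat by rewrite ffunE.
apply/forall_inP => h hE; apply/forallP => a; apply/implyP => /andP[].
case/imsetP => u uh aE few; subst a; apply/cards1P; exists u.
apply/setP => v; rewrite !inE; apply/andP/eqP => [[vh /eqP Fvu]|-> //].
apply: contraTeq few => vu; rewrite eq_sym in vu.
have [|T [Th Tc Ti Tu]] := fT h u v hE uh vh vu; first by rewrite -!FE Fvu.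
rewrite -leqNgt (leq_trans (geq_minr _ _)) // -Tc.
have Fi : {in T &, injective F}.
  by move=> x y xT yT /(congr1 val); rewrite /= !FE; apply: Ti.
rewrite -(card_in_imset Fi); apply/subset_leq_card/subsetP => _ /imsetP[w wT ->].
by rewrite inE imset_f ?(subsetP Th) // !FE Tu.
Qed.

(** * The number of rounds and the final constant *)

(** $(1-1/q)^j \le e^{-j/q} < 1/n$. *)
Lemma rounds_bound (R : realType) (n q j : nat) :
  0 < n -> 0 < q -> (q%:R * ln n%:R < j%:R :> R)%R -> n * q.-1 ^ j < q ^ j.
Proof.
move=> n0 q0 lnj; have n0R : (0 < n%:R :> R)%R by rewrite ltr0n.
have q0R : (0 < q%:R :> R)%R by rewrite ltr0n.
have predE : (q.-1%:R = q%:R * (1 - q%:R^-1) :> R)%R.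
  by rewrite mulrBr mulr1 mulfV ?gt_eqF // -subn1 natrB.
rewrite -(ltr_nat R) natrM !natrX predE exprMn mulrCA.
rewrite -[X in (_ < X)%R]mulr1 ltr_pM2l ?exprn_gt0 //.
have pos : (0 <= 1 - q%:R^-1 :> R)%R.
  by rewrite subr_ge0 invf_le1 // ler1n.
have le : ((1 - q%:R^-1) ^+ j <= expR (- (j%:R / q%:R)) :> R)%R.
  rewrite -mulrN expRM_natl lerXn2r ?nnegrE ?expR_ge0 //; exact: expR_ge1Dx.
apply: le_lt_trans (ler_wpM2l (ltW n0R) le) _.
rewrite -[X in (X * _)%R]lnK ?posrE // -expRD -[ltRHS]expR0 ltr_expR subr_lt0.
by rewrite ltr_pdivlMr // mulrC.
Qed.

(** This lower bound lets the rounding of [j] be absorbed into the main term. It follows from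
    $\ln(1+x) \le x$ at $x=-1/2$. *)
Lemma ln_ge_half (R : realType) (n : nat) : 2 <= n -> (1 / 2 <= ln n%:R :> R)%R.
Proof.
move=> n2; apply: (@le_trans _ _ (ln 2)); last first.
  by rewrite ler_ln ?posrE ?ltr0n ?ler_nat //; apply: leq_trans n2.
have := @le_ln1Dx R (- 2^-1)%R; have -> : (1 - 2^-1 = 2^-1 :> R)%R by field.
rewrite lnV ?posrE //; lra.
Qed.

Local Open Scope ring_scope.

Theorem theorem4p6 (R : realType) :
  exists C : R, 0 < C /\
    forall (t : nat) (c : R) (V : finType) (E : {set {set V}}),
      0 < c ->
      hereditary_linear_delaunay c E ->
      (chi_um t E)%:R <= Num.max 1 (C * (c * t%:R * ln (#|V|)%:R)).
Proof.
(* 22 is 18 from [q_le] plus 4 for rounding [j] up. The bound 1 covers [t = 0] and the case where no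
   hyperedge has two vertices. *)
exists 22; split=> // t c V E c0 hE; rewrite le_max.
have [t0|t0] := posnP t.
  apply/orP; left; rewrite (ler_nat _ _ 1).
  apply: (@chi_um_le _ _ _ _ (fun=> 0%N)) => // h u v _ _ _ _ _.
  by exists set0; rewrite sub0set cards0 t0; split=> // x; rewrite inE.
have [/exists_inP[h hE' h2]|small] := boolP [exists h in E, 1 < #|h|]%N; last first.
  apply/orP; left; rewrite (ler_nat _ _ 1).
  apply: (@chi_um_le _ _ _ _ (fun=> 0%N)) => // h u v hE' uh vh uv _.
  have : (1 < #|h|)%N by apply/card_gt1P; exists u, v.
  by move: small; rewrite negb_exists_in => /forall_inP/(_ _ hE')/negbTE ->.
apply/orP; right.
have n2 : (2 <= #|V|)%N by apply: leq_trans h2 (max_card _).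
(* Restricting to two vertices of [h] leaves a Delaunay edge, so $1 \le 2c$. *)
have c_half : 1 / 2 <= c.
  have [x [y [xh yh xy]]] := card_gt1P h2.
  have e2 : #|[set x; y]| = 2 by rewrite cards2 xy.
  have : (0 < #|delaunay_edges (induced_edges E [set x; y])|)%N.
    rewrite card_gt0; apply/set0Pn; exists [set x; y].
    rewrite inE e2 eqxx andbT; apply/imsetP; exists h => //.
    by apply/esym/setIidPr/subsetP => w; rewrite !inE => /orP[] /eqP ->.
  have := hE [set x; y]; rewrite e2 -(ler_nat R 1) => le lt.
  by lra.
pose q := (Num.truncn (8 * c * t.+1%:R)).+1.
have q_gt : 8 * c * t.+1%:R < q%:R by apply: truncnS_gt.
(* As $t \ge 1$, $8c(t+1) \le 16ct$, and the rounding costs $1 \le 2c \le 2ct$. *)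
have q_le : q%:R <= 18 * c * t%:R.
  have t1 : 1 <= t%:R :> R by rewrite ler1n.
  rewrite /q -natr1; have : (Num.truncn (8 * c * t.+1%:R))%:R <= 8 * c * t.+1%:R.
    by rewrite truncn_le !mulr_ge0 // ltW.
  rewrite -natr1; nra.
have sparse (W : {set V}) : W != set0 ->
    (2 * #|close_pairs E W t.+1| < #|W| * q)%N.
  rewrite -card_gt0 => W0; rewrite -(ltr_nat R) !natrM.
  have := card_close_pairs W c0 hE (ltn0Sn t).
  have : 0 < #|W|%:R :> R by rewrite ltr0n.
  by nra.
pose j := (Num.truncn (q%:R * ln #|V|%:R : R)).+1.
have ln2 := ln_ge_half R n2.
have [|f fj fT] := um_rounds sparse (j := j) (W := [set: V]).
  rewrite cardsT; apply: (@rounds_bound R) => //; first exact: ltnW.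
  exact: truncnS_gt.
have : (chi_um t E <= j)%N.
  apply: (chi_um_le (f := f)) => [v|h' u v h'E uh vh uv fuv].
    by rewrite fj.
  have [||T] := fT h' u v h'E _ _ uv fuv; rewrite ?setIT //.
  by exists T.
rewrite -(ler_nat R) => le; apply: le_trans le _.
have : j%:R <= q%:R * ln #|V|%:R + 1 :> R.
  by rewrite /j -natr1 lerD2r truncn_le mulr_ge0 //; lra.
have : q%:R * ln #|V|%:R <= 18 * c * t%:R * ln #|V|%:R :> R.
  by rewrite ler_wpM2r //; lra.
have : 1 / 2 <= c * t%:R.
  by rewrite (le_trans c_half) // ler_peMr ?ler1n // ltW.
(* $ct$ and $\ln|V|$ are both at least $1/2$, so $1 \le 4ct\ln|V|$. *)
set x := ln _ in ln2 *; nra.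
Qed.
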